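(* Let $F$ be a commutative field, $S$ a non-empty set, $g\ge1$, $n\in\{1,\dots,g\}$, $M=g(g+1)/2$, $L:=M-(g-n)(g-n+1)/2$. Let $x_1,\dots,x_L\in S$, let $p_{n+1},\dots,p_g\in S$, and let $f_1,\dots,f_g$ be $F$-valued functions on $S$. The conditions $$f_i(p_j)=\delta_{ij},\qquad 1\le i\le j,\quad n+1\le j\le g,$$ imply $$\det\nolimits_{I_{M,n}}ff(x_1,\dots,x_L)=\frac{1}{c_{g,n}}\sum_{s\in\mathcal P_L}\epsilon(s)\prod_{j=1}^n\det f(x_{d^j(s)})\prod_{k=n+1}^{g+1}\det f(x_{d^k_1(s)},\dots,x_{d^k_n(s)},p_{n+1},\dots,p_g),$$ where $$c_{g,n}:=\sum_{(\tilde r^1,\dots,\tilde r^{g+1})\in\mathcal P_g^{\,n}\times\mathcal P_n^{\,g-n+1}}\ \prod_{k=1}^{g+1}\epsilon(\tilde r^k)\ \epsilon\bigl(\varkappa(\tilde r^1,\dots,\tilde r^{g+1})\bigr).$$ In particular, for $n=g$, $$c_g\det ff(x_1,\dots,x_M)=\sum_{s\in\mathcal P_M}\epsilon(s)\prod_{j=1}^{g+1}\det f(x_{d^j(s)}),$$ where $$c_g:=c_{g,g}=\sum_{r^1,\dots,r^{g+1}\in\mathcal P_g}\ \prod_{k=1}^{g+1}\epsilon(r^k)\ \epsilon\bigl(\varkappa(r^1,\dots,r^{g+1})\bigr).$$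
   Context: $I_n:=\{1,\dots,n\}$, $\mathcal P_n$ is the permutation group of $I_n$. Fix a surjection $m:I_g\times I_g\to I_M$ with $m(i,j)=m(j,i)$ (so $m$ induces a bijection from unordered pairs onto $I_M$). $I_{M,n}:=\{m(i,j)\mid i\in I_n,\ j\in I_g\}\subset I_M$, with the order inherited from $I_M$; it has $L$ elements, and we identify $I_{M,n}$ with $I_L$ by the order-preserving bijection (for a suitable choice of $m$ one has $I_{M,n}=I_L$ as ordered sets), so that for $s\in\mathcal P_L$ and $l\in I_{M,n}$ the symbol $s_l\in I_L$ makes sense. For $s\in\mathcal P_L$ set $d^i_j(s)=d^{j+1}_i(s):=s_{m(i,j)}$ for $i\le j$ in $I_g$ with $i\in I_n$; i.e. $d^k_i(s)=s_{m(k,i)}$ if $i\ge k$ and $d^k_i(s)=s_{m(i,k-1)}$ if $i<k$. This defines $d^k(s)=(d^k_1(s),\dots,d^k_g(s))$ for $k\le n$ and $d^k_1(s),\dots,d^k_n(s)$ for $n<k\le g+1$. $ff_{m(i,j)}:=f_if_j$; $\det_{I_{M,n}}ff(x_1,\dots,x_L):=\det(ff_l(x_i))_{i\in I_L,\,l\in I_{M,n}}$ (subscript omitted if $n=g$); $\det f(y_1,\dots,y_g):=\det(f_k(y_i))_{k,i\in I_g}$ and $\det f(x_{d^j(s)}):=\det(f_k(x_{d^j_i(s)}))_{i,k\in I_g}$. The map $\varkappa(\tilde r^1,\dots,\tilde r^{g+1}):I_{M,n}\to I_M$ is defined by $\varkappa_{m(i,j)}(\tilde r^1,\dots,\tilde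 r^{g+1})=m(\tilde r^i_j,\tilde r^{j+1}_i)$, $i\le j$, $i\in I_n$, $j\in I_g$, where $\tilde r^1,\dots,\tilde r^n\in\mathcal P_g$ and $\tilde r^{n+1},\dots,\tilde r^{g+1}\in\mathcal P_n$. $\epsilon$ is the sign of a permutation; $\epsilon(\varkappa)$ is the sign of $\varkappa$ if $\varkappa$ is a permutation of $I_{M,n}$, and $0$ otherwise (when $\varkappa$ is injective it is automatically a permutation of $I_{M,n}$).
   Formalization: Since c_{g,n} can vanish in F (e.g. c_{2,1}=2 in characteristic 2), where 1/c_{g,n} is undefined, the first formula is stated as c_{g,n} times the determinant equals the sum, for every field F, and in the form with 1/c_{g,n} only when c_{g,n} is nonzero in F. *)

(* Defs.v *)
From HB Require Import structures.
From mathcomp Require Import all_boot all_order all_algebra all_fingroup.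

Set Implicit Arguments.
Unset Strict Implicit.
Unset Printing Implicit Defensive.

Import GRing.Theory.
Local Open Scope ring_scope.

(* Conventions.  The sets I_n = {1, ..., n} are rendered by the ordinals 'I_n *)
(* = {0, ..., n-1}: every index is shifted down by one.  In particular the    *)
(* superscripts k = 1, ..., g+1 of d^k and r^k are elements of 'I_g.+1, and   *)
(* the range "k <= n" (resp. "k > n") becomes k < n (resp. n <= k).           *)

Definition cardM (g : nat) : nat := ((g * g.+1) %/ 2)%N.

Definition cardL (g n : nat) : nat :=
  (cardM g - ((g - n) * (g - n).+1) %/ 2)%N.

Record pairing (g : nat) := Pairing {
  pairing_fun :> 'I_g -> 'I_g -> 'I_(cardM g);
  pairingC : forall i j, pairing_fun i j = pairing_fun j i;
  pairing_surj : forall l, exists i j, pairing_fun i j = l }.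

Section Labels.

Variables (g : nat) (m : pairing g).

Fact unpair_subproof (l : 'I_(cardM g)) :
  exists ij : 'I_g * 'I_g, (ij.1 <= ij.2)%N && (m ij.1 ij.2 == l).
Proof.
have [i [j <-]] := pairing_surj m l.
case: (leqP i j) => [le_ij | /ltnW le_ji]; first by exists (i, j); rewrite le_ij /=.
by exists (j, i); rewrite le_ji /= pairingC.
Qed.

Definition unpair (l : 'I_(cardM g)) : 'I_g * 'I_g := xchoose (unpair_subproof l).

Lemma unpair_le l : ((unpair l).1 <= (unpair l).2)%N.
Proof. by case/andP: (xchooseP (unpair_subproof l)). Qed.

Lemma unpairK l : m (unpair l).1 (unpair l).2 = l.
Proof. by case/andP: (xchooseP (unpair_subproof l)) => _ /eqP. Qed.

Lemma card_ge_ord (i : 'I_g) : #|[set j : 'I_g | (i <= j)%N]| = (g - i)%N.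
Proof.
rewrite cardsE -sum1_card.
rewrite -(big_mkord (fun j => i <= j)%N (fun=> 1%N)).
rewrite (big_cat_nat (n := i)) ?(ltnW (ltn_ord i)) //=.
rewrite big_nat_cond big_pred0 => [|j]; last first.
  by apply/negP => /andP[/andP[_ +] +]; rewrite ltnNge => /negP.
rewrite big_nat_cond add0n (eq_bigl (fun j => (i <= j < g)%N && true)) => [|j].
  by rewrite -big_nat_cond sum_nat_const_nat muln1.
by case: (i <= j)%N; rewrite /= ?andbF ?andbT.
Qed.

Lemma card_le_pairs (n : nat) :
  #|[set ij : 'I_g * 'I_g | (ij.1 <= ij.2)%N & (n <= ij.1)%N]|
  = (((g - n) * (g - n).+1) %/ 2)%N.
Proof.
rewrite cardsE -sum1_card.
transitivity (\sum_(i < g | n <= i) \sum_(j < g | i <= j) 1)%N.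
  rewrite pair_big_dep /=; apply: eq_bigl => -[i j] /=.
  by rewrite unfold_in /= andbC.
transitivity (\sum_(i < g | n <= i) (g - i))%N.
  apply: eq_bigr => i _; rewrite -card_ge_ord cardsE -sum1_card.
  exact: eq_bigl.
rewrite -(big_mkord (fun i => n <= i)%N (fun i => g - i)%N).
case: (leqP g n) => [le_gn | /ltnW le_ng].
  have /eqP -> : (g - n == 0)%N by rewrite subn_eq0.
  rewrite big_nat_cond big_pred0 // => i.
  apply/negP => /andP[/andP[_ lt_ig] le_ni].
  by have := leq_trans lt_ig (leq_trans le_gn le_ni); rewrite ltnn.
rewrite (big_cat_nat (n := n)) //= big_nat_cond big_pred0 => [|j]; last first.
  by apply/negP => /andP[/andP[_ +] +]; rewrite ltnNge => /negP.
rewrite add0n big_nat_cond (eq_bigl (fun j => (n <= j < g)%N && true)); last first.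
  by move=> j; case: (n <= j)%N; rewrite /= ?andbF ?andbT.
rewrite -big_nat_cond -{1}(subnK le_ng); move: (g - n)%N (subnK le_ng) => k eg.
rewrite -{1}[n]add0n big_addn addnK -eg.
under eq_bigr do rewrite subnDr.
elim: k {eg} => [|k IHk]; first by rewrite big_nil.
rewrite big_nat_recl // subn0; under eq_bigr do rewrite subSS.
by rewrite IHk -divnMDl // [(k * _)%N]mulnC -mulnDr add2n.
Qed.

Lemma pairing_inj :
  {in [set ij : 'I_g * 'I_g | (ij.1 <= ij.2)%N] &,
     injective (fun ij : 'I_g * 'I_g => m ij.1 ij.2)}.
Proof.
apply/imset_injP; apply/eqP.
have -> : [set ij : 'I_g * 'I_g | (ij.1 <= ij.2)%N]
        = [set ij : 'I_g * 'I_g | (ij.1 <= ij.2)%N & (0 <= ij.1)%N].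
  by apply/setP => ij; rewrite !inE andbT.
rewrite card_le_pairs subn0 -[RHS]/(cardM g) -[RHS]card_ord -cardsT.
congr #|pred_of_set _|; apply/setP => l; rewrite inE; apply/imsetP.
by exists (unpair l); rewrite ?inE ?unpair_le ?unpairK.
Qed.

Definition IMn (n : nat) : {set 'I_(cardM g)} :=
  [set l | [exists i : 'I_g, exists j : 'I_g, (i < n)%N && (m i j == l)]].

Lemma card_IMn (n : nat) : #|IMn n| = cardL g n.
Proof.
pose D := [set ij : 'I_g * 'I_g | (ij.1 <= ij.2)%N].
pose B := [set ij : 'I_g * 'I_g | (ij.1 <= ij.2)%N & (n <= ij.1)%N].
have -> : IMn n = [set m ij.1 ij.2 | ij in D :\: B].
  apply/setP => l; rewrite inE; apply/existsP/imsetP => [[i /existsP[j]] | [[i j]]].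
    case/andP=> lt_in /eqP <-; case: (leqP i j) => [le_ij | lt_ji].
      by exists (i, j); rewrite // !inE le_ij /= -ltnNge lt_in.
    exists (j, i); last exact: pairingC.
    by rewrite !inE (ltnW lt_ji) /= -ltnNge (ltn_trans lt_ji).
  rewrite !inE /= => /andP[+ le_ij] ->; rewrite le_ij /= -ltnNge => lt_in.
  by exists i; apply/existsP; exists j; rewrite lt_in eqxx.
rewrite card_in_imset; last first.
  move=> u v; rewrite !inE => /andP[_ uD] /andP[_ vD].
  by apply: pairing_inj; rewrite inE.
rewrite cardsD (setIidPr _) ?card_le_pairs; last first.
  by apply/subsetP => ij; rewrite !inE => /andP[].
congr (_ - _)%N; rewrite /cardM -[in RHS](subn0 g) -card_le_pairs.
by congr #|pred_of_set _|; apply/setP => ij; rewrite !inE andbT.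
Qed.

(* The order-preserving bijection I_L -> I_{M,n} : enum_val follows enum,     *)
(* which lists a set of ordinals in increasing order.                         *)
Definition label (n : nat) (t : 'I_(cardL g n)) : 'I_(cardM g) :=
  enum_val (cast_ord (esym (card_IMn n)) t).

Fact IMn_witness (n : nat) (g_gt0 : (0 < g)%N) (n_gt0 : (0 < n)%N) :
  m (Ordinal g_gt0) (Ordinal g_gt0) \in IMn n.
Proof.
rewrite inE; apply/existsP; exists (Ordinal g_gt0).
by apply/existsP; exists (Ordinal g_gt0); rewrite n_gt0 eqxx.
Qed.

(* The inverse bijection I_{M,n} -> I_L; the value outside I_{M,n} is junk.   *)
Definition rank_IMn (n : nat) (g_gt0 : (0 < g)%N) (n_gt0 : (0 < n)%N)
    (l : 'I_(cardM g)) : 'I_(cardL g n) :=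
  cast_ord (card_IMn n) (enum_rank_in (IMn_witness g_gt0 n_gt0) l).

Lemma rank_IMnK n g_gt0 n_gt0 : {in IMn n, cancel (@rank_IMn n g_gt0 n_gt0) (@label n)}.
Proof. by move=> l lI; rewrite /label /rank_IMn cast_ordK enum_rankK_in. Qed.

Lemma label_in n t : @label n t \in IMn n.
Proof. exact: enum_valP. Qed.

Lemma labelK n g_gt0 n_gt0 : cancel (@label n) (@rank_IMn n g_gt0 n_gt0).
Proof. by move=> t; rewrite /rank_IMn /label enum_valK_in cast_ordKV. Qed.

Lemma label_mono n : {mono @label n : t u / (t < u)%N}.
Proof.
have lt_mono (v w : 'I_(cardL g n)) : (v < w)%N -> (label v < label w)%N.
  move=> lt_vw; rewrite /label /enum_val.
  rewrite (set_nth_default (enum_default (cast_ord (esym (card_IMn n)) w)));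
    last by rewrite -cardE.
  have lt_trans : transitive (fun a b : 'I_(cardM g) => (a < b)%N).
    by move=> a b c; apply: ltn_trans.
  have srt : sorted (fun a b : 'I_(cardM g) => (a < b)%N) (enum (IMn n)).
    apply: sorted_filter => //; rewrite -enumT.
    have := iota_ltn_sorted 0 (cardM g); rewrite -val_enum_ord sorted_map.
    by [].
  by apply: (sorted_ltn_nth lt_trans _ srt); rewrite ?inE -?cardE.
move=> t u; case: (ltngtP t u) => [/lt_mono // | /lt_mono lt_ut | /val_inj ->].
  by apply/negbTE; rewrite -leqNgt ltnW.
by rewrite ltnn.
Qed.

(* d^k_i = m(k,i) if i >= k and m(i,k-1) if i < k, so that d^k_i(s) is s      *)
(* applied to it.  In each branch the argument of insubd is < g, hence its    *)
(* default value is not used.                                                 *)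
Definition dlabel (k : 'I_g.+1) (i : 'I_g) : 'I_(cardM g) :=
  if (k <= i)%N then m (insubd i (k : nat)) i else m i (insubd i k.-1).

(* The values of kappa outside I_{M,n} are irrelevant.  The superscripts i    *)
(* and j+1 in I_{g+1} are rendered by widen_ord and lift ord0.                *)
Definition kappa (r : 'I_g.+1 -> 'S_g) (l : 'I_(cardM g)) : 'I_(cardM g) :=
  let: (i, j) := unpair l in
  m (r (widen_ord (leqnSn g) i) j) (r (lift ord0 j) i).

End Labels.

(* The sign of the restriction of h to A if it is a permutation of A, and 0   *)
(* otherwise.                                                                 *)
Definition sign_on (T : finType) (A : {set T}) (h : T -> T) : int :=
  if [pick u : {perm T} | perm_on A u && [forall l in A, u l == h l]] is Some u
  then (-1) ^+ u else 0.

(* P_n is taken inside P_g, as the permutations supported in I_n; thus r      *)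
(* ranges over P_g^n x P_n^(g-n+1).                                           *)
Definition c_gn (g : nat) (m : pairing g) (n : nat) : int :=
  \sum_(r : {ffun 'I_g.+1 -> 'S_g}
        | [forall k : 'I_g.+1,
             (n <= k)%N ==> perm_on [set i : 'I_g | (i < n)%N] (r k)])
     (\prod_(k < g.+1) (-1) ^+ r k) * sign_on (IMn m n) (kappa m r).

Definition c_g (g : nat) (m : pairing g) : int := c_gn m g.

Section Determinants.

Variables (F : fieldType) (S : Type) (g : nat) (m : pairing g).
Variable f : 'I_g -> S -> F.

Definition ff (l : 'I_(cardM g)) (y : S) : F :=
  f (unpair m l).1 y * f (unpair m l).2 y.

Lemma ffE i j y : ff (m i j) y = f i y * f j y.
Proof.
wlog le_ij : i j / (i <= j)%N => [H|].
  by case: (leqP i j) => [/H // | /ltnW /H]; rewrite pairingC mulrC.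
suff eq_ij : unpair m (m i j) = (i, j) by rewrite /ff eq_ij.
by apply: (@pairing_inj _ m); rewrite ?inE ?unpair_le ?unpairK.
Qed.

Definition detf (y : 'I_g -> S) : F := \det (\matrix_(k, i) f k (y i)).

Definition detff (x : 'I_(cardM g) -> S) : F :=
  \det (\matrix_(i, l) ff l (x i)).

Definition detff_IMn (n : nat) (x : 'I_(cardL g n) -> S) : F :=
  \det (\matrix_(i, t) ff (label m t) (x i)).

End Determinants.

(* Main.v *)
Require Import Defs.
From mathcomp Require Import all_boot all_order all_algebra all_fingroup.
Import GRing.Theory.
Local Open Scope ring_scope.

(** Expand every determinant in the product over all its permutations.  For
    k < n the k-th factor contributes a sum over all r^k in P_g.  For k >= n
    the columns f(p_n), ..., f(p_(g-1)) form a unit triangular block with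
    zeros above it, so only the r^k that fix the indices i >= n survive, each
    with a coefficient 1 from those columns (lemma detf_expand).  The right
    hand side is therefore a sum over s and over exactly the tuples r that
    index c_gn.

    For fixed r and s, the monomial has one factor f_(r^k_i)(x_(d^k_i(s))) for
    each slot (k, i) with k < n or i < n.  Each label l = m(i, j) with i <= j
    is attached to exactly two slots, (i, j) and (j + 1, i), so the monomial is
    the product over l of ff_(kappa l)(x_(s_l)) (lemmas big_slots and kappaE).
    The alternating sum over s is then the determinant of the matrix
    ff_(kappa l)(x_i).  It vanishes when kappa is not injective on I_{M,n}, as
    two columns agree; otherwise kappa permutes I_{M,n} and the determinant is
    its sign times the left hand determinant (lemma det_sign_on).  Summing
    over r gives c_gn.

    That an injective kappa permutes I_{M,n} is a degree count.  Read the
    labels as the edges, loops included, of the complete graph on g vertices,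
    whose vertices all have degree g + 1.  The edges kappa(l) already give
    degree g + 1 to each vertex v < n (lemma sum_degree_kappa), so if they are
    distinct they exhaust the edges meeting {0, ..., n-1}, which are I_{M,n};
    equality of cardinals concludes (lemma kappa_inj_stable).

    The expansion is proved for an arbitrary enumeration lab of I_{M,n}.  The
    increasing enumeration gives the general formula, and the identity gives
    the case n = g without any transport from I_L to I_M. *)

(** * Signs of restricted permutations *)

(** Both the hypotheses and the parity are compatible with multiplying v by a
    transposition (a b) and u by (h a  h b), which reduces v to the identity. *)
Lemma odd_perm_transport (T U : finType) (h : T -> U) (v : {perm T})
    (u : {perm U}) :
  injective h -> (forall t, u (h t) = h (v t)) ->
  (forall y, y \notin codom h -> u y = y) -> odd_perm u = odd_perm v.
Proof.
move=> h_inj; have [ts -> _] := prod_tpermP v.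
elim: ts u => [|[a b] ts IHts] u uh uout.
  suff -> : u = 1%g by rewrite big_nil !odd_perm1.
  apply/permP => y; rewrite perm1.
  have [/codomP[t ->]|/uout//] := boolP (y \in codom h).
  by rewrite uh big_nil perm1.
pose u' := (tperm (h a) (h b) * u)%g.
have u'h t : u' (h t) = h ((\prod_(t0 <- ts) tperm t0.1 t0.2)%g t).
  rewrite permM -(inj_tperm _ _ _ h_inj) uh big_cons permM.
  by rewrite tpermK.
have u'out y : y \notin codom h -> u' y = y.
  move=> yh; rewrite permM tpermD ?uout //.
    by apply: contraNneq yh => <-; apply: codom_f.
  by apply: contraNneq yh => <-; apply: codom_f.
have := IHts u' u'h u'out; rewrite odd_mul_tperm => eq_odd.
rewrite big_cons odd_mul_tperm -eq_odd /= (inj_eq h_inj).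
by rewrite addbA addbb.
Qed.

Lemma sign_onE (T : finType) (A : {set T}) (h : T -> T) (u : {perm T}) :
  perm_on A u -> {in A, u =1 h} -> sign_on A h = (-1) ^+ u.
Proof.
move=> uA uh; rewrite /sign_on; case: pickP => [w /andP[wA /forall_inP wh]|].
  suff -> : w = u by [].
  apply/permP => y; have [yA|yA] := boolP (y \in A).
    by rewrite (eqP (wh y yA)) uh.
  by rewrite (out_perm wA yA) (out_perm uA yA).
by move/(_ u); rewrite uA /=; case: forall_inP => // -[l /uh/eqP].
Qed.

Lemma sign_on_neq0 (T : finType) (A : {set T}) (h : T -> T) :
  sign_on A h != 0 -> {in A &, injective h}.
Proof.
rewrite /sign_on; case: pickP => [w /andP[_ /forall_inP wh] _|]; last by rewrite eqxx.
by move=> y z yA zA; rewrite -(eqP (wh y yA)) -(eqP (wh z zA)) => /perm_inj.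
Qed.

(** If h is injective on A it permutes A, hence permutes the columns; otherwise
    two columns coincide.  The image inclusion is only asked for in the first
    case because that is how it becomes available for kappa, whose values may
    leave I_{M,n} when it is not injective. *)
Lemma det_sign_on (R : comPzRingType) (T : finType) (A : {set T}) (h : T -> T)
    (L : nat) (lab : 'I_L -> T) (rk : T -> 'I_L) (phi : T -> 'I_L -> R) :
  (forall t, lab t \in A) -> cancel lab rk -> {in A, cancel rk lab} ->
  ({in A &, injective h} -> [set h y | y in A] \subset A) ->
  \det (\matrix_(i, t) phi (h (lab t)) i)
    = (sign_on A h)%:~R * \det (\matrix_(i, t) phi (lab t) i).
Proof.
move=> labA labK rkK hA.
have [/injectiveP h_inj | /injectivePn[t [t' ne_tt' eq_h]]] :=
  boolP (injectiveb (fun t => h (lab t))); last first.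
  have -> : sign_on A h = 0.
    apply: contra_neq_eq ne_tt' => /sign_on_neq0 h_inj.
    by apply: (can_inj labK); apply: h_inj.
  rewrite mul0r -det_tr; apply: (determinant_alternate ne_tt') => i.
  by rewrite !mxE eq_h.
have hA_inj : {in A &, injective h}.
  move=> y z yA zA eq_yz; rewrite -(rkK y yA) -(rkK z zA); congr lab.
  by apply: h_inj; rewrite !rkK.
pose u := perm_in hA_inj (hA hA_inj).
have uA : perm_on A u := perm_in_on _ _.
have uh : {in A, u =1 h} := perm_inE _ _.
have v_inj : injective (fun t => rk (u (lab t))).
  by apply: (can_inj (g := fun t => rk ((u^-1)%g (lab t)))) => t;
    rewrite /= rkK ?(perm_closed _ uA) // permK labK.
pose v := perm v_inj.
have uv t : u (lab t) = lab (v t) by rewrite [v t]permE rkK ?(perm_closed _ uA).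
have odd_uv : odd_perm u = odd_perm v.
  apply: (odd_perm_transport _ _ lab _ _ (can_inj labK) uv) => y ynotin.
  apply: (out_perm uA); apply: contra ynotin => yA.
  by apply/codomP; exists (rk y); rewrite rkK.
rewrite (sign_onE _ _ _ u uA uh) odd_uv rmorphXn rmorphN1.
have -> : \matrix_(i, t) phi (h (lab t)) i
          = col_perm v (\matrix_(i, t) phi (lab t) i).
  by apply/matrixP => i t; rewrite !mxE -uv uh.
by rewrite col_permE det_mulmx det_perm odd_permV mulrC.
Qed.

(** * Reindexing the slots (k, i) by the labels *)

Section Slots.

Variables (g : nat) (m : pairing g).

Lemma unpair_pairing (i j : 'I_g) : (i <= j)%N -> unpair m (m i j) = (i, j).
Proof. by move=> le_ij; apply: (@pairing_inj _ m); rewrite ?inE ?unpair_le ?unpairK. Qed.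

(** The set I_{M,n} is defined from one endpoint, but m is symmetric and has no
    other coincidences, so membership can be tested on any representative. *)
Lemma mem_IMn n (i j : 'I_g) : (m i j \in IMn m n) = (i < n)%N || (j < n)%N.
Proof.
apply/idP/idP => [|/orP[lt_in|lt_jn]]; last 2 first.
- by rewrite inE; apply/existsP; exists i; apply/existsP; exists j; rewrite lt_in eqxx.
- by rewrite inE; apply/existsP; exists j; apply/existsP; exists i;
    rewrite lt_jn pairingC eqxx.
rewrite inE => /existsP[i' /existsP[j' /andP[lt_i'n /eqP]]].
wlog le_ij : i j / (i <= j)%N => [H|].
  by case: (leqP i j) => [/H // | /ltnW /H]; rewrite (pairingC m j i) orbC.
move=> /(congr1 (unpair m)); rewrite (unpair_pairing i j) //.
case: (leqP i' j') => [le_i'j' | /ltnW le_j'i'].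
  by rewrite unpair_pairing // => -[<- _]; rewrite lt_i'n.
by rewrite pairingC unpair_pairing // => -[_ <-]; rewrite lt_i'n orbT.
Qed.

Lemma IMn_full : IMn m g = setT.
Proof. by apply/setP => l; rewrite -(unpairK m l) mem_IMn ltn_ord inE. Qed.

Lemma big_IMn (R : Type) (idx : R) (op : Monoid.com_law idx) n
    (K : 'I_g * 'I_g -> R) :
  \big[op/idx]_(l in IMn m n) K (unpair m l)
  = \big[op/idx]_(i < g | (i < n)%N) \big[op/idx]_(j < g | (i <= j)%N) K (i, j).
Proof.
rewrite (reindex_onto (fun ij => m ij.1 ij.2) (unpair m)) => [|l _]; last exact: unpairK.
rewrite pair_big_dep /=; apply: eq_big => [[i j]|[i j] /andP[_ /eqP ->] //] /=.
rewrite mem_IMn; case: (leqP i j) => [le_ij | lt_ji].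
  rewrite unpair_pairing // eqxx !andbT; apply/orb_idr => lt_jn.
  exact: leq_ltn_trans le_ij lt_jn.
rewrite andbF; apply/negbTE/nandP; right.
apply: contraL lt_ji => /eqP eq_ij; rewrite -leqNgt.
by have := unpair_le m (m i j); rewrite eq_ij.
Qed.

(** The two superscripts k such that l labels some d^k_i: the one with k <= i and
    the one with i < k. *)
Definition low_slot (l : 'I_(cardM g)) := widen_ord (leqnSn g) (unpair m l).1.
Definition high_slot (l : 'I_(cardM g)) := lift ord0 (unpair m l).2.

(** Label l = m(i, j) with i <= j owns the slot (i, j), where k <= position, and
    the slot (j + 1, i), where position < k; the condition i < n reads k < n on
    the first kind of slot and position < n on the second.  It is stated for
    any commutative operation since it is applied both to products of values
    of f and to sums of degrees. *)
Lemma big_slots (R : Type) (idx : R) (op : Monoid.com_law idx) n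
    (H : 'I_g.+1 -> 'I_g -> R) :
  \big[op/idx]_(k < g.+1) \big[op/idx]_(i < g | (k < n)%N || (i < n)%N) H k i
  = \big[op/idx]_(l in IMn m n)
      op (H (low_slot l) (unpair m l).2) (H (high_slot l) (unpair m l).1).
Proof.
rewrite big_split /=.
rewrite (big_IMn _ _ op n (fun ij => H (widen_ord (leqnSn g) ij.1) ij.2)).
rewrite (big_IMn _ _ op n (fun ij => H (lift ord0 ij.2) ij.1)) /=.
transitivity
  (op (\big[op/idx]_(k < g.+1) \big[op/idx]_(i < g | (k <= i)%N && (k < n)%N) H k i)
      (\big[op/idx]_(k < g.+1) \big[op/idx]_(i < g | (i < k)%N && (i < n)%N) H k i)).
  rewrite -big_split; apply: eq_bigr => k _ /=.
  rewrite (bigID (fun i : 'I_g => (k <= i)%N)) /=; congr (op _ _).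
    apply: eq_bigl => i; case: (leqP k i) => [le_ki|]; rewrite ?andbF // !andbT /=.
    by apply/orb_idr; apply: leq_ltn_trans.
  apply: eq_bigl => i; rewrite -ltnNge.
  case: (ltnP i k) => [lt_ik|]; rewrite ?andbF // !andbT /=.
  by apply/orb_idl; apply: ltn_trans.
congr (op _ _).
  rewrite big_ord_recr /= [X in op _ X]big_pred0 => [|i]; last by rewrite leqNgt ltn_ord.
  rewrite Monoid.mulm1 [RHS]big_mkcond; apply: eq_bigr => k _ /=.
  by case: (k < n)%N; [apply: eq_bigl => i | apply: big_pred0 => i]; rewrite ?andbT ?andbF.
rewrite big_ord_recl /= [X in op X _]big_pred0 // Monoid.mul1m.
rewrite (exchange_big_dep (fun i : 'I_g => (i < n)%N)) /=; last by move=> ? ? _ /andP[].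
apply: eq_bigr => i lt_in; apply: eq_bigl => j.
by rewrite lt_in andbT.
Qed.

Lemma dlabel_low l : dlabel m (low_slot l) (unpair m l).2 = l.
Proof.
rewrite /dlabel /= unpair_le -[RHS](unpairK m); congr (m _ _).
by apply: val_inj; rewrite val_insubd ltn_ord.
Qed.

Lemma dlabel_high l : dlabel m (high_slot l) (unpair m l).1 = l.
Proof.
rewrite /dlabel /= ltnNge unpair_le -[RHS](unpairK m); congr (m _ _).
by apply: val_inj; rewrite val_insubd ltn_ord.
Qed.

Lemma kappaE r l :
  kappa m r l = m (r (low_slot l) (unpair m l).2) (r (high_slot l) (unpair m l).1).
Proof. by rewrite /kappa /low_slot /high_slot; case: (unpair m l). Qed.

(** * Injective kappa permutes the labels: a degree count *)

(** Labels are read as edges, loops included, on the vertices of 'I_g; a loop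
    adds 2 to the degree of its vertex. *)
Definition degree (v : 'I_g) (l : 'I_(cardM g)) : nat :=
  ((unpair m l).2 == v) + ((unpair m l).1 == v).

Lemma degree_pairing v (i j : 'I_g) : degree v (m i j) = ((i == v) + (j == v))%N.
Proof.
rewrite /degree; case: (leqP i j) => [/unpair_pairing -> | /ltnW lt_ji] /=.
  by rewrite addnC.
by rewrite pairingC unpair_pairing.
Qed.

Lemma sum_pred1_perm (A : {set 'I_g}) (u : 'S_g) v :
  perm_on A u -> v \in A -> (\sum_(i in A) (u i == v) = 1)%N.
Proof.
move=> uA vA; have uVA : (u^-1)%g v \in A by rewrite (perm_closed _ (perm_onV uA)).
rewrite (bigD1 _ uVA) /= permKV eqxx big1 // => i /andP[_ ne_iv].
by apply/eqP; rewrite eqb0; apply: contra ne_iv => /eqP <-; rewrite permK.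
Qed.

(** The endpoints of the edges kappa(l) are the values r^k_i at the slots, and
    each r^k takes the value v exactly once on its slots: for k < n they are
    all of {0, ..., g-1}, for k >= n they are {0, ..., n-1}, which r^k
    preserves and which contains v. *)
Lemma sum_degree_kappa n (r : 'I_g.+1 -> 'S_g) (v : 'I_g) :
  (v < n)%N ->
  (forall k : 'I_g.+1, (n <= k)%N -> perm_on [set i : 'I_g | (i < n)%N] (r k)) ->
  (\sum_(l in IMn m n) degree v (kappa m r l) = g.+1)%N.
Proof.
move=> lt_vn r_on.
under eq_bigr do rewrite kappaE degree_pairing.
rewrite -(big_slots _ _ _ n (fun k i => nat_of_bool (r k i == v))).
rewrite -[RHS]card_ord -sum1_card; apply: eq_bigr => k _.
have [lt_kn | le_nk] /= := ltnP k n.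
  rewrite -[RHS](@sum_pred1_perm setT (r k) v) ?inE //.
    by apply: eq_bigl => i; rewrite inE.
  by apply/subsetP => i _; rewrite inE.
rewrite -[RHS](sum_pred1_perm _ _ v (r_on k le_nk)) ?inE //.
by apply: eq_bigl => i; rewrite inE.
Qed.

(** The previous count for n = g and trivial r, where kappa is the identity. *)
Lemma sum_degree v : (\sum_l degree v l = g.+1)%N.
Proof.
rewrite -[RHS](sum_degree_kappa g (fun _ => 1%g) v) //; last first.
  by move=> k _; apply: perm_on1.
apply: eq_big => [l|l _]; first by rewrite IMn_full inE.
by rewrite kappaE !perm1 pairingC unpairK.
Qed.

(** Distinct edges kappa(l) already saturate the degree of every v < n, so an
    edge outside their image meets no such v, that is, lies outside I_{M,n}.
    The image thus contains I_{M,n}, and has no more elements than it. *)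
Lemma kappa_inj_stable n (r : 'I_g.+1 -> 'S_g) :
  (forall k : 'I_g.+1, (n <= k)%N -> perm_on [set i : 'I_g | (i < n)%N] (r k)) ->
  {in IMn m n &, injective (kappa m r)} ->
  [set kappa m r l | l in IMn m n] \subset IMn m n.
Proof.
move=> r_on inj_kappa; set B := [set _ | _ in _].
suff subB : IMn m n \subset B.
  by have /eqP <- : IMn m n == B by rewrite eqEcard subB card_in_imset /=.
apply/subsetP => l lI; apply: contraLR lI => lB.
rewrite -(unpairK m l) mem_IMn negb_or.
have deg0 (v : 'I_g) : (v < n)%N -> degree v l = 0%N.
  move=> lt_vn; have := sum_degree v.
  rewrite (bigID (mem B)) /= big_imset //= sum_degree_kappa //.
  move/eqP; rewrite -[X in _ == X]addn0 eqn_add2l sum_nat_eq0.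
  by move/forall_inP/(_ l lB)/eqP.
by rewrite -!leqNgt; apply/andP; split; rewrite leqNgt; apply/negP => /deg0;
  rewrite /degree eqxx ?addn1 ?add1n.
Qed.

End Slots.

(** * Expansion of the product of determinants *)

(** Downward induction on i: a value u i > i is already the image of u i. *)
Lemma perm_fix_of_increasing_tail g n (u : 'S_g) :
  (forall i : 'I_g, (n <= i)%N -> (i <= u i)%N) ->
  forall i : 'I_g, (n <= i)%N -> u i = i.
Proof.
move=> u_ge i; have [d] := ubnP (g - i); elim: d i => // d IHd i lt_d le_ni.
apply/eqP; rewrite eq_sym -(inj_eq val_inj) eqn_leq u_ge //= leqNgt.
apply/negP => lt_i; have lt_d' : (g - u i < d)%N.
  by rewrite -ltnS; apply: leq_trans lt_d; rewrite ltnS; apply: ltn_sub2l.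
have /perm_inj eq_i := IHd _ lt_d' (leq_trans le_ni (ltnW lt_i)).
by move: lt_i; rewrite eq_i ltnn.
Qed.

(** A permutation u which moves some i >= n has u i < i for some such i, and its
    term contains the factor f_(u i)(p_i) = 0. *)
Lemma detf_expand (F : fieldType) (S : Type) g n (f : 'I_g -> S -> F)
    (y p : 'I_g -> S) :
  (forall i j : 'I_g, (i <= j)%N -> (n <= j)%N -> f i (p j) = (i == j)%:R) ->
  detf f (fun i => if (i < n)%N then y i else p i)
  = \sum_(u : 'S_g | perm_on [set i : 'I_g | (i < n)%N] u)
      (-1) ^+ u * \prod_(i < g | (i < n)%N) f (u i) (y i).
Proof.
move=> fp; rewrite /detf -det_tr /determinant.
rewrite (bigID (perm_on [set i : 'I_g | (i < n)%N])) /= [X in _ + X]big1 ?addr0.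
  apply: eq_bigr => u u_on; congr (_ * _).
  rewrite (bigID (fun i : 'I_g => (i < n)%N)) /= [X in _ * X]big1 ?mulr1.
    by apply: eq_bigr => i lt_in; rewrite !mxE lt_in.
  move=> i nlt_in; rewrite !mxE (negbTE nlt_in) (out_perm u_on) ?inE //.
  by rewrite fp ?eqxx // leqNgt.
move=> u u_off.
have /existsP[i /andP[le_ni lt_ui]] : [exists i : 'I_g, (n <= i)%N && (u i < i)%N].
  apply: contraNT u_off; rewrite negb_exists => /forallP u_ge.
  apply/subsetP => i; rewrite !inE; apply: contraR; rewrite -leqNgt => le_ni.
  apply/eqP; apply: (perm_fix_of_increasing_tail g n _ _ _ le_ni) => j le_nj.
  by have := u_ge j; rewrite le_nj /= -leqNgt.
rewrite (bigD1 i) //= !mxE ltnNge le_ni /= fp ?(ltnW lt_ui) //.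
by rewrite -(inj_eq val_inj) ltn_eqF // mul0r mulr0.
Qed.

Lemma perm_on_full g (u : 'S_g) : perm_on [set i : 'I_g | (i < g)%N] u.
Proof. by apply/subsetP => i _; rewrite inE ltn_ord. Qed.

(** The identity of the theorem before choosing how I_L is identified with
    I_{M,n}: lab lists the labels and rk is its inverse. *)
Lemma det_expansion (F : fieldType) (S : Type) g (m : pairing g)
    (f : 'I_g -> S -> F) (n : nat) (L : nat) (lab : 'I_L -> 'I_(cardM g))
    (rk : 'I_(cardM g) -> 'I_L) (x : 'I_L -> S) (p : 'I_g -> S) :
  (forall t, lab t \in IMn m n) -> cancel lab rk -> {in IMn m n, cancel rk lab} ->
  (forall i j : 'I_g, (i <= j)%N -> (n <= j)%N -> f i (p j) = (i == j)%:R) ->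
  (c_gn m n)%:~R * \det (\matrix_(i, t) ff m f (lab t) (x i))
  = \sum_(s : 'S_L) (-1) ^+ s
     * (\prod_(k < g.+1 | (k < n)%N) detf f (fun i => x (s (rk (dlabel m k i)))))
     * (\prod_(k < g.+1 | (n <= k)%N)
          detf f (fun i => if (i < n)%N then x (s (rk (dlabel m k i))) else p i)).
Proof.
move=> labI labK rkK fp.
pose Q (k : 'I_g.+1) (u : 'S_g) :=
  (n <= k)%N ==> perm_on [set i : 'I_g | (i < n)%N] u.
pose slot_prod (s : 'S_L) (r : 'I_g.+1 -> 'S_g) :=
  \prod_(k < g.+1) \prod_(i < g | (k < n)%N || (i < n)%N)
     f (r k i) (x (s (rk (dlabel m k i)))).
transitivity (\sum_(s : 'S_L) \sum_(r : {ffun 'I_g.+1 -> 'S_g} | r \in family Q)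
   (-1) ^+ s * ((\prod_(k < g.+1) (-1) ^+ r k) * slot_prod s r)); last first.
  apply: eq_bigr => s _; rewrite -big_distrr /= -mulrA; congr (_ * _).
  under eq_bigr => r _ do rewrite -big_split.
  rewrite -(@bigA_distr_big_dep _ _ _ _ _ _ _ Q (fun k u => (-1) ^+ u *
     \prod_(i < g | (k < n)%N || (i < n)%N) f (u i) (x (s (rk (dlabel m k i)))))).
  rewrite (bigID (fun k : 'I_g.+1 => (k < n)%N)) /=; congr (_ * _).
    apply: eq_bigr => k lt_kn; rewrite lt_kn /=.
    rewrite /detf -det_tr; apply: eq_big => u; first by rewrite /Q leqNgt lt_kn.
    by move=> _; congr (_ * _); apply: eq_bigr => i _; rewrite !mxE.
  apply: eq_big => k; first by rewrite -leqNgt.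
  rewrite -leqNgt => le_nk; rewrite (detf_expand _ _ _ n) //.
  apply: eq_big => [u|u _]; first by rewrite /Q le_nk.
  by rewrite ltnNge le_nk.
rewrite exchange_big /= /c_gn rmorph_sum /= big_distrl /=.
apply: eq_big => [r|r /forallP r_on].
  by rewrite unfold_in; apply: eq_forallb => k.
have r_on' (k : 'I_g.+1) : (n <= k)%N -> perm_on [set i : 'I_g | (i < n)%N] (r k).
  by move=> le_nk; have := r_on k; rewrite le_nk.
transitivity (\prod_(k < g.+1) (-1) ^+ r k *
    \det (\matrix_(i, t) ff m f (kappa m r (lab t)) (x i)) : F).
  rewrite (det_sign_on _ _ (IMn m n) _ _ lab rk (fun l i => ff m f l (x i))) //; last first.
    exact: kappa_inj_stable.
  rewrite rmorphM mulrA; congr (_ * _ * _).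
  by rewrite rmorph_prod; apply: eq_bigr => k _; rewrite rmorphXn rmorphN1.
(* In the transpose, s sends the column t of a label to the row of x_(s t). *)
rewrite -det_tr big_distrr /=; apply: eq_bigr => s _; rewrite mulrCA; congr (_ * (_ * _)).
rewrite /slot_prod (big_slots _ m _ _ _ n
  (fun k i => f (r k i) (x (s (rk (dlabel m k i)))))) /=.
rewrite [RHS](reindex_onto lab rk) //; apply: eq_big => [t|t _].
  by rewrite labI labK eqxx.
by rewrite !mxE dlabel_low dlabel_high labK kappaE ffE.
Qed.

Theorem lemma2p5 (F : fieldType) (S : Type) (S_neq0 : inhabited S)
    (g : nat) (g_gt0 : (0 < g)%N) (m : pairing g) (f : 'I_g -> S -> F) :
  (forall (n : nat) (n_gt0 : (0 < n)%N) (n_le_g : (n <= g)%N)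
      (x : 'I_(cardL g n) -> S) (p : 'I_g -> S),
    (forall i j : 'I_g, (i <= j)%N -> (n <= j)%N -> f i (p j) = (i == j)%:R) ->
    let d (s : 'S_(cardL g n)) (k : 'I_g.+1) (i : 'I_g) :=
      s (rank_IMn m g_gt0 n_gt0 (dlabel m k i)) in
    let rhs : F :=
      \sum_(s : 'S_(cardL g n)) (-1) ^+ s
        * (\prod_(k < g.+1 | (k < n)%N) detf f (fun i => x (d s k i)))
        * (\prod_(k < g.+1 | (n <= k)%N)
             detf f (fun i => if (i < n)%N then x (d s k i) else p i)) in
    (c_gn m n)%:~R * detff_IMn m f x = rhs
    /\ ((c_gn m n)%:~R != 0 :> F ->
        detff_IMn m f x = 1 / (c_gn m n)%:~R * rhs))
  /\
  (forall x : 'I_(cardM g) -> S,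
    (c_g m)%:~R * detff m f x
    = \sum_(s : 'S_(cardM g)) (-1) ^+ s
        * \prod_(k < g.+1) detf f (fun i => x (s (dlabel m k i))))
  /\
  c_g m = \sum_(r : {ffun 'I_g.+1 -> 'S_g})
            (\prod_(k < g.+1) (-1) ^+ r k) * sign_on setT (kappa m r).
Proof.
split=> [n n_gt0 n_le_g x p fp d rhs | ].
  have eq_rhs : (c_gn m n)%:~R * detff_IMn m f x = rhs.
    apply: det_expansion => //.
    - exact: label_in.
    - exact: labelK.
    - exact: rank_IMnK.
  by split=> // c_neq0; rewrite -eq_rhs mul1r mulKf.
split=> [x|].
  (* For n = g there is no p_j to constrain, so any point of S will do. *)
  case: S_neq0 => y0.
  have fp (i j : 'I_g) : (i <= j)%N -> (g <= j)%N -> f i y0 = (i == j)%:R.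
    by rewrite [(g <= j)%N]leqNgt ltn_ord.
  have full t : t \in IMn m g by rewrite IMn_full inE.
  rewrite [LHS](det_expansion _ _ _ m f g _ id id x (fun=> y0)) //.
  apply: eq_bigr => s _; rewrite -mulrA; congr (_ * _).
  rewrite [RHS](bigID (fun k : 'I_g.+1 => (k < g)%N)) /=; congr (_ * _).
  apply: eq_big => k; first by rewrite -leqNgt.
  move=> _; congr (\det _); apply/matrixP => a i.
  by rewrite !mxE ltn_ord.
rewrite /c_g /c_gn IMn_full; apply: eq_bigl => r.
by apply/forallP => k; rewrite perm_on_full implybT.
Qed.
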